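(* Let $\mathbf Y$ be an $\mathrm{EMTP}_2$ Hüsler--Reiss distribution with parameter matrix $\Gamma\in\mathcal C^d$ and precision matrix $\Theta$ that is an extremal graphical model on its extremal pairwise independence graph $G=(V,E)$, that is, $\Theta_{ij}=0$ if and only if $(i,j)\notin E$ (for $i\neq j$). Suppose that $\overline\Gamma=\overline\Gamma_n$ is a consistent estimator of $\Gamma$ as the sample size $n\to\infty$ (i.e. $\overline\Gamma_n\to\Gamma$ in probability), and let $\widehat\Gamma$ be the corresponding $\mathrm{EMTP}_2$ estimator. Then the estimated $\mathrm{EMTP}_2$ graph $\widehat G=(V,\widehat E)$ is asymptotically a super-graph of the true underlying graph $G$; more precisely, $$\mathbb P(E\subseteq\widehat E)\to1,\qquad n\to\infty.$$
   Context: $V=\{1,\dots,d\}$. $\mathbb S^d_0$ is the space of symmetric real $d\times d$ matrices with zero diagonal, with $\langle\!\langle A,B\rangle\!\rangle=\sum_{i<j}A_{ij}B_{ij}$; $\boldsymbol 1$ is the vector of ones. $\mathcal C^d\subset\mathbb S^d_0$ is the set of $\Gamma$ with $\boldsymbol x^T\Gamma\boldsymbol x<0$ for all $\boldsymbol x\ne\boldsymbol 0$ with $\boldsymbol x^T\boldsymbol 1=0$. The Hüsler--Reiss distribution with parameter $\Gamma\in\mathcal C^d$ has precision matrix $\Theta=(\boldsymbol P(-\tfrac12\Gamma)\boldsymbol P)^+$ (Moore--Penrose inverse; $\boldsymbol P=I_d-\frac1d\boldsymbol 1\boldsymbol 1^T$), and it is $\mathrm{EMTP}_2$ if and only if $\Theta_{ij}\le0$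 for all $i\ne j$ (this characterization may be taken as the meaning of $\mathrm{EMTP}_2$ here). $\mathrm{EMTP}_2$ estimator: $\overline\Gamma_n$ are random elements of $\mathbb S^d_0$. Let $\mathbb U_+\subset\mathbb S^d_0$ be the set of entrywise nonnegative $Q$ whose support is the edge set of a connected graph on $V$, and $\ell(Q;\overline\Gamma)=\log\big(\sum_{T\in\mathcal T}\prod_{ij\in T}Q_{ij}\big)-\langle\!\langle\overline\Gamma,Q\rangle\!\rangle$, $\mathcal T$ being the set of spanning trees of the complete graph on $V$. Let $\widehat Q=\arg\max_{Q\in\mathbb U_+}\ell(Q;\overline\Gamma)$; the maximizer exists (and is unique) if and only if $\overline\Gamma_{ij}>0$ for all $i\ne j$ (on the complementary event the estimator may be defined arbitrarily). $\widehat\Theta$ has off-diagonal entries $-\widehat Q_{ij}$ and zero row sums, $\widehat\Sigma=\widehat\Theta^+$, and $\widehat\Gamma_{ij}=\widehat\Sigma_{ii}+\widehat\Sigma_{jj}-2\widehat\Sigma_{ij}$. The $\mathrm{EMTP}_2$ graph $\widehat G=(V,\widehat E)$ is defined by $(i,j)\notin\widehat E\Leftrightarrow\widehat Q_{ij}=0$ for $i\neq j$. *)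

(* Defs.v *)
From HB Require Import structures.
From mathcomp Require Import all_boot all_order all_algebra.
From mathcomp Require Import all_classical all_reals all_analysis.

Set Implicit Arguments.
Unset Strict Implicit.
Unset Printing Implicit Defensive.

Import Order.TTheory GRing.Theory Num.Theory.
Import numFieldNormedType.Exports.

Local Open Scope classical_set_scope.
Local Open Scope ring_scope.

Section MoorePenrose.
Variable R : realFieldType.

Definition is_moore_penrose (m n : nat) (A : 'M[R]_(m, n)) (B : 'M[R]_(n, m)) :=
  [/\ A *m B *m A = A, B *m A *m B = B,
      (A *m B)^T = A *m B & (B *m A)^T = B *m A].

(* MathComp's [pinvmx] is only a one-sided partial inverse, not the
   Moore-Penrose inverse. *)
Definition moore_penrose (m n : nat) (A : 'M[R]_(m, n)) : 'M[R]_(n, m) :=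
  xget 0 [set B | is_moore_penrose A B].

Lemma is_moore_penrose_uniq (m n : nat) (A : 'M[R]_(m, n)) B C :
  is_moore_penrose A B -> is_moore_penrose A C -> B = C.
Proof.
move=> [ABA BAB ABt BAt] [ACA CAC ACt CAt].
have AB_AC : A *m B = A *m C.
  by rewrite -ABt -{1}ACA -mulmxA trmx_mul ABt ACt !mulmxA ABA.
have BA_CA : B *m A = C *m A.
  by rewrite -BAt -{1}ACA mulmxA -(mulmxA B) mulmxA mulmxA -mulmxA trmx_mul
     BAt CAt -mulmxA (mulmxA A) ABA.
by rewrite -BAB BA_CA -mulmxA AB_AC mulmxA CAC.
Qed.

Lemma row_free_gram_unit (m n : nat) (F : 'M[R]_(m, n)) :
  row_free F -> F *m F^T \in unitmx.
Proof.
move=> Ffree; rewrite -row_free_unit -kermx_eq0; apply/eqP/row_matrixP => i.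
rewrite row0; set u := row i _.
have uFF : u *m (F *m F^T) = 0 by rewrite -row_mul mulmx_ker row0.
have norm0 : (u *m F) *m (u *m F)^T = 0.
  by rewrite trmx_mul mulmxA -(mulmxA u) uFF mul0mx.
have uF0 : u *m F = 0.
  apply/rowP => j; rewrite [RHS]mxE; apply/eqP.
  have /matrixP/(_ 0 0) := norm0; rewrite [LHS]mxE [RHS]mxE => /eqP.
  rewrite psumr_eq0 => [/allP/(_ j)|k _]; last by rewrite [in X in _ * X]mxE -expr2 sqr_ge0.
  by rewrite mem_index_enum => /(_ isT); rewrite [in X in _ * X]mxE mulf_eq0 orbb.
by apply: (row_free_inj Ffree); rewrite uF0 mul0mx.
Qed.

Lemma moore_penrose_factor (m n r : nat) (C : 'M[R]_(m, r)) (F : 'M[R]_(r, n)) :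
  row_full C -> row_free F ->
  is_moore_penrose (C *m F)
    (F^T *m invmx (F *m F^T) *m (invmx (C^T *m C) *m C^T)).
Proof.
move=> Cfull Ffree; have FU := row_free_gram_unit Ffree.
have CU : C^T *m C \in unitmx.
  rewrite -{2}(trmxK C); apply: row_free_gram_unit.
  by rewrite /row_free mxrank_tr.
set X := invmx (F *m F^T); set Y := invmx (C^T *m C).
have Xt : X^T = X by rewrite trmx_inv trmx_mul trmxK.
have Yt : Y^T = Y by rewrite trmx_inv trmx_mul trmxK.
have FX : F *m (F^T *m X) = 1%:M by rewrite mulmxA mulmxV.
have YC : Y *m C^T *m C = 1%:M by rewrite -mulmxA mulVmx.
have AB : C *m F *m (F^T *m X *m (Y *m C^T)) = C *m (Y *m C^T).
  by rewrite -mulmxA (mulmxA F) FX mul1mx.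
have BA : F^T *m X *m (Y *m C^T) *m (C *m F) = F^T *m X *m F.
  by rewrite -mulmxA (mulmxA (Y *m C^T)) YC mul1mx.
split.
- by rewrite AB mulmxA -(mulmxA C) YC mulmx1.
- by rewrite BA mulmxA -(mulmxA (F^T *m X)) FX mulmx1.
- by rewrite AB !trmx_mul trmxK Yt mulmxA.
- by rewrite BA !trmx_mul trmxK Xt mulmxA.
Qed.

Lemma moore_penroseP (m n : nat) (A : 'M[R]_(m, n)) :
  is_moore_penrose A (moore_penrose A).
Proof.
have := moore_penrose_factor (col_base_full A) (row_base_free A).
by rewrite mulmx_base => AB; exact: (xgetPex 0 (ex_intro _ _ AB)).
Qed.

End MoorePenrose.

Section Defs.
Variables (R : realType) (d : nat).
Implicit Types (A B Gam Q Th Sig : 'M[R]_d) (e : rel 'I_d).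

Definition sym0 A := A^T = A /\ forall i, A i i = 0.

Definition mxdot A B : R := \sum_(i < d) \sum_(j < d | (i < j)%N) A i j * B i j.

Definition ones : 'cV[R]_d := const_mx 1.

Definition cond_negdef Gam :=
  sym0 Gam /\ forall x : 'cV[R]_d, x != 0 -> x^T *m ones = 0 ->
    (x^T *m Gam *m x) 0 0 < 0.

Definition centering : 'M[R]_d := 1%:M - d%:R^-1 *: (ones *m ones^T).

Definition HR_precision Gam : 'M[R]_d :=
  moore_penrose (centering *m (- 2^-1 *: Gam) *m centering).

Definition EMTP2 Gam := forall i j, i != j -> HR_precision Gam i j <= 0.

Definition connected_graph e := forall i j, connect e i j.

(* [ucycle e p] closes up the simple path [p]; in a simple graph the cycles of
   size at most 2 are degenerate. *)
Definition acyclic_graph e := forall p : seq 'I_d, ucycle e p -> (size p <= 2)%N.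

(* The undirected edge {i, j} is encoded by the pair (i, j) with i < j. *)
Definition edge_rel (T : {set 'I_d * 'I_d}) : rel 'I_d :=
  fun i j => ((i, j) \in T) || ((j, i) \in T).

Definition spanning_tree (T : {set 'I_d * 'I_d}) :=
  [/\ forall i j, (i, j) \in T -> (i < j)%N,
      connected_graph (edge_rel T) & acyclic_graph (edge_rel T)].

Definition tree_poly Q : R :=
  \sum_(T : {set 'I_d * 'I_d} | `[< spanning_tree T >]) \prod_(ij in T) Q ij.1 ij.2.

Definition loglik Q Gam : R := ln (tree_poly Q) - mxdot Gam Q.

Definition support_graph Q : rel 'I_d := fun i j => (i != j) && (Q i j != 0).

Definition Uplus : set 'M[R]_d :=
  [set Q | [/\ sym0 Q, forall i j, 0 <= Q i j & connected_graph (support_graph Q)]].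

Definition is_argmax (T : Type) (D : set T) (f : T -> R) (x : T) :=
  D x /\ forall y, D y -> f y <= f x.

Definition laplacian Q : 'M[R]_d :=
  \matrix_(i, j) (if i == j then \sum_(k | k != i) Q i k else - Q i j).

Definition variogram Sig : 'M[R]_d :=
  \matrix_(i, j) (Sig i i + Sig j j - 2 * Sig i j).

Definition pos_offdiag Gam := forall i j, i != j -> 0 < Gam i j.

(* [Gh] is the EMTP2 estimator computed from the surrogate variogram [Gb], and
   [Qh] the maximizer through which it is defined. *)
Definition EMTP2_estimator Gb Qh Gh :=
  is_argmax Uplus (fun Q => loglik Q Gb) Qh /\
  Gh = variogram (moore_penrose (laplacian Qh)).

Definition cvg_in_prob (disp : measure_display) (Omega : measurableType disp)
    (P : probability Omega R) (X : nat -> Omega -> 'M[R]_d) A :=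
  forall eps : R, 0 < eps ->
    (fun n => P [set w | eps <= `|X n w - A|]) @ \oo --> 0%E.

End Defs.

(* Main.v *)
Require Import Defs.
From HB Require Import structures.
From mathcomp Require Import all_boot all_order all_algebra.
From mathcomp Require Import all_classical all_reals all_analysis.
From mathcomp Require Import ring lra.

(** By the weighted matrix-tree theorem [tree_poly Q] is proportional to
    [\det (L + J)], where [L] is the Laplacian of [Q] and [J] the all-ones matrix.
    The gradient of its logarithm is therefore the matrix of effective
    resistances [b (L + J)^-1 b^T], [b] being the edge vectors, and a maximizer
    satisfies the KKT conditions: the resistance of each edge is at most the
    entry of the variogram, with equality on the support. The weights [- Theta i j]
    satisfy these conditions at the true [Gam], all with equality.

    If [Q1], [Q2] satisfy the conditions for [G1], [G2], and [A1], [A2], [D] denote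
    the two augmented Laplacians and their difference, then adding the conditions
    bounds [\tr (A1^-1 D A2^-1 D)] by the pairing of [G1 - G2] with [Q2 - Q1].
    That trace is at least [\tr (D D^T) / (\tr A1 \tr A2)], and the
    complementarity conditions bound the traces, so solutions depend
    continuously on the variogram. Hence the support of the maximizer can only
    grow near [Gam]; the same continuity makes the event measurable. *)

Set Implicit Arguments.
Unset Strict Implicit.
Unset Printing Implicit Defensive.

Import Order.TTheory GRing.Theory Num.Theory.
Import numFieldNormedType.Exports.

Local Open Scope classical_set_scope.
Local Open Scope ring_scope.

(** * The matrix-tree theorem *)

(** A form of the Cauchy-Binet formula: the determinant is expanded over the choices [f] of one term
    for each row, and the injective choices are grouped by their image. *)
Lemma det_weighted_gram (F : comNzRingType) (I : finType) (n : nat)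
    (b : I -> 'rV[F]_n) :
  exists2 c : {set I} -> F,
    forall w : I -> F,
      \det (\sum_e w e *: ((b e)^T *m b e)) = \sum_(U : {set I}) (\prod_(e in U) w e) * c U
  & (forall U : {set I}, #|U| != n -> c U = 0) /\
    (forall f : 'I_n -> I, injective f ->
       c (f @: [set: 'I_n])%SET = \det (\matrix_i b (f i)) ^+ 2).
Proof.
pose inj_onto (U : {set I}) (f : {ffun 'I_n -> I}) :=
  injectiveb f && ((f @: [set: 'I_n])%SET == U).
pose c U := \sum_(f | inj_onto U f)
   (\prod_i b (f i) 0 i) * \det (\matrix_i b (f i)).
have cE w : \det (\sum_e w e *: ((b e)^T *m b e)) =
            \sum_(U : {set I}) (\prod_(e in U) w e) * c U.
  transitivity (\sum_(f : {ffun 'I_n -> I})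
      \prod_i (w (f i) * b (f i) 0 i) * \det (\matrix_i b (f i))).
    rewrite /determinant.
    under eq_bigr => s _.
      under eq_bigr => i _.
        rewrite summxE.
        under eq_bigr => e _ do rewrite 2!mxE big_ord1 mxE mulrA.
        over.
      rewrite bigA_distr_bigA mulr_sumr /=.
      over.
    rewrite exchange_big; apply: eq_bigr => f _ /=.
    rewrite mulr_sumr; apply: eq_bigr => s _.
    rewrite mulrCA; congr (_ * _); rewrite -big_split /=.
    by apply: eq_bigr => i _; rewrite mxE.
  rewrite (bigID (fun f : {ffun 'I_n -> I} => injectiveb f)) /=.
  rewrite [X in _ + X]big1 ?addr0; last first.
    move=> f /injectivePn[i [j ij fij]].
    by rewrite (determinant_alternate ij) ?mulr0// => k; rewrite !mxE fij.
  rewrite (partition_big (fun f : {ffun 'I_n -> I} => (f @: [set: 'I_n])%SET) xpredT)//=.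
  apply: eq_bigr => U _; rewrite mulr_sumr; apply: eq_bigr => f.
  move=> /andP[/injectiveP finj /eqP <-].
  rewrite big_split /= -mulrA; congr (_ * _).
  rewrite big_imset/=; last by move=> x y _ _; exact: finj.
  by apply: eq_bigl => i; rewrite inE.
have c0 (U : {set I}) : #|U| != n -> c U = 0.
  move=> Un; apply: big1 => f /andP[/injectiveP finj /eqP fU].
  by move: Un; rewrite -fU card_imset// cardsT card_ord eqxx.
exists c => //; split=> // f finj.
set U := (f @: [set: 'I_n])%SET.
have cardU : #|U| = n by rewrite card_imset// cardsT card_ord.
(* With the indicator of [U] as weight only the term of [U] survives, and the weighted sum becomes a
   Gram matrix. *)
transitivity (\det (\sum_e (e \in U)%:R *: ((b e)^T *m b e))).
  rewrite cE (bigD1 U)//= [X in X * _]big1 => [|e ->//].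
  rewrite mul1r big1 ?addr0// => W WU.
  have [cardW|/c0->] := eqVneq #|W| n; last by rewrite mulr0.
  have /subsetPn[e eW eU] : ~~ (W \subset U).
    by apply: contra WU => WU; rewrite eqEcard WU cardU cardW/=.
  by rewrite (bigD1 e)//= (negbTE eU) !mul0r.
rewrite expr2 -[X in _ = X * _]det_tr -det_mulmx; congr (\det _).
rewrite (bigID (mem U)) /= [X in _ + X]big1 ?addr0; last first.
  by move=> e /negbTE->; rewrite scale0r.
rewrite big_imset/=; last by move=> x y _ _; exact: finj.
rewrite (eq_bigl xpredT) => [|i]; last by rewrite inE.
apply/matrixP => k l. rewrite summxE mxE; apply: eq_bigr => i _.
by rewrite imset_f ?inE// scale1r !mxE big_ord1 mxE.
Qed.

Lemma sum_option_pair (V : nmodType) (I J : finType) (F : option (I * J) -> V) :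
  \sum_e F e = F None + \sum_i \sum_j F (Some (i, j)).
Proof.
rewrite (bigD1 None)//= pair_bigA/=; congr (_ + _).
rewrite (reindex_omap Some id) => [|[i|]//].
by apply: eq_big => [i|[i j] _//]; rewrite eqxx.
Qed.

Lemma sum_pair_sym (V : nmodType) (d : nat) (g : 'I_d -> 'I_d -> V) :
  (forall i j, g i j = g j i) -> (forall i, g i i = 0) ->
  \sum_i \sum_j g i j = (\sum_(i < d) \sum_(j < d | (i < j)%N) g i j) *+ 2.
Proof.
move=> gC g0; rewrite mulr2n.
rewrite [X in _ = _ + X](exchange_big_dep xpredT)//= -big_split/=.
apply: eq_bigr => i _; rewrite (bigID (fun j : 'I_d => (i < j)%N))/=; congr (_ + _).
rewrite (bigID (fun j : 'I_d => (j < i)%N))/= [X in _ + X]big1 ?addr0.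
  by apply: eq_big => [j|j _]; [rewrite -leqNgt; case: ltngtP | rewrite gC].
move=> j; rewrite -!leqNgt -eqn_leq => /eqP ji.
by rewrite (_ : i = j) ?g0//; apply: val_inj.
Qed.

(* The index [None] stands for the all-ones vector. *)
Definition edge_vec (F : nzRingType) (d : nat) (e : option ('I_d * 'I_d)) : 'rV[F]_d :=
  if e is Some (i, j) then delta_mx 0 i - delta_mx 0 j else const_mx 1.

Arguments edge_vec : clear implicits.

Definition edge_weight (R : nzRingType) (d : nat) (Q : 'M[R]_d)
    (e : option ('I_d * 'I_d)) : R :=
  if e is Some (i, j) then (if (i < j)%N then Q i j else 0) else 1.

(* Adding the all-ones matrix makes the Laplacian of a connected graph
   invertible without changing how it acts on vectors of zero sum. *)
Definition aug (R : realType) (d : nat) (Q : 'M[R]_d) : 'M[R]_d :=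
  laplacian Q + const_mx 1.

(** * The augmented Laplacian *)

Section Aug.
Variables (R : realType) (d : nat).
Implicit Types (Q : 'M[R]_d) (x : 'rV[R]_d).
Local Notation b := (edge_vec R d).

Lemma edge_vecE i j k : b (Some (i, j)) 0 k = (k == i)%:R - (k == j)%:R.
Proof. by rewrite !mxE !eqxx. Qed.

Lemma aug_edge_sum Q : sym0 Q ->
  aug Q = \sum_e edge_weight Q e *: ((b e)^T *m b e).
Proof.
move=> [Qt Q0]; rewrite sum_option_pair scale1r addrC; congr (_ + _); last first.
  by apply/matrixP => i j; rewrite !mxE big_ord1 !mxE mulr1.
have QC i j : Q i j = Q j i by rewrite -{1}Qt mxE.
(* Both sides are doubled so that the sum over [i < j] becomes a sum over all ordered pairs. *)
apply/matrixP => k l; apply/eqP; rewrite -(@eqr_pMn2r _ 2)//; apply/eqP.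
have -> : (\sum_(i < d) \sum_(j < d) (if (i < j)%N then Q i j else 0) *:
    ((b (Some (i, j)))^T *m b (Some (i, j)))) k l =
  \sum_(i < d) \sum_(j < d | (i < j)%N)
     Q i j * (b (Some (i, j)) 0 k * b (Some (i, j)) 0 l).
  rewrite summxE; apply: eq_bigr => i _; rewrite summxE [RHS]big_mkcond/=.
  apply: eq_bigr => j _; rewrite 2!mxE big_ord1 mxE; case: ifP => //= _.
  by rewrite mul0r.
rewrite -sum_pair_sym; last 2 first.
- by move=> i j; rewrite QC !edge_vecE; ring.
- by move=> i; rewrite Q0 mul0r.
under eq_bigr => i _ do under eq_bigr => j _ do rewrite !edge_vecE.
transitivity (\sum_i \sum_j (Q i j * ((k == i)%:R * (l == i)%:R) -
     Q i j * ((k == i)%:R * (l == j)%:R)) +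
  \sum_i \sum_j (Q i j * ((k == j)%:R * (l == j)%:R) -
     Q i j * ((k == j)%:R * (l == i)%:R))); last first.
  rewrite -big_split; apply: eq_bigr => i _; rewrite -big_split.
  by apply: eq_bigr => j _ /=; ring.
rewrite [X in _ + X]exchange_big/=.
have E : \sum_i \sum_j (Q i j * ((k == i)%:R * (l == i)%:R) -
     Q i j * ((k == i)%:R * (l == j)%:R)) = laplacian Q k l.
  rewrite (bigD1 k)//= [X in _ + X]big1 ?addr0 => [|i ik]; last first.
    by apply: big1 => j _; rewrite eq_sym (negbTE ik) !mul0r mulr0 subrr.
  rewrite eqxx mxE sumrB; under eq_bigr do rewrite mul1r.
  rewrite -mulr_suml [X in _ - X](bigD1 l)//= [X in _ - (_ + X)]big1 ?addr0; last first.
    by move=> j jl; rewrite eq_sym (negbTE jl) mulr0 mulr0.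
  rewrite eqxx !mulr1 [k == l]eq_sym; case: eqVneq => [->|lk]; last first.
    by rewrite mulr0 add0r.
  by rewrite mulr1 (bigD1 k)//= Q0 add0r subr0.
rewrite mulr2n -[in X in X + _ = _]E -E; congr (_ + _).
by apply: eq_bigr => i _; apply: eq_bigr => j _; rewrite QC.
Qed.

Lemma aug_sym Q : sym0 Q -> (aug Q)^T = aug Q.
Proof.
move=> /aug_edge_sum->; rewrite linear_sum; apply: eq_bigr => e _.
by rewrite linearZ /= trmx_mul trmxK.
Qed.

Lemma edge_weight_ge0 Q e : (forall i j, 0 <= Q i j) -> 0 <= edge_weight Q e.
Proof. by move=> Q0; case: e => [[i j]|]//=; case: ifP. Qed.

Lemma aug_qform Q x : sym0 Q ->
  (x *m aug Q *m x^T) 0 0 = \sum_e edge_weight Q e * ((b e *m x^T) 0 0) ^+ 2.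
Proof.
move=> /aug_edge_sum->; rewrite mulmx_sumr mulmx_suml summxE.
apply: eq_bigr => e _; rewrite -scalemxAr -scalemxAl mxE; congr (_ * _).
rewrite mulmxA -[_ *m b e *m _]mulmxA mxE big_ord1 expr2; congr (_ * _).
by rewrite -[in LHS](trmxK x) -trmx_mul mxE.
Qed.

Lemma edge_vec_mul i j x : (b (Some (i, j)) *m x^T) 0 0 = x 0 i - x 0 j.
Proof. by rewrite mulmxBl -!rowE !mxE. Qed.

Lemma connected_const (T : Type) (e : rel 'I_d) (x : 'I_d -> T) :
  connected_graph e -> (forall i j, e i j -> x i = x j) -> forall i j, x i = x j.
Proof.
move=> con xe i j; have /connectP[p] := con i j.
by elim: p i => [|k p IHp] i /= => [_ ->//|/andP[/xe-> kp]]; exact: IHp.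
Qed.

(** A kernel vector has zero quadratic form: the edge terms make it constant on the connected
    support, and the all-ones term then makes it zero. *)
Lemma aug_unit Q : Uplus Q -> aug Q \in unitmx.
Proof.
move=> [Qs Q0 Qcon]; rewrite -row_free_unit -kermx_eq0.
apply/eqP/row_matrixP => k; rewrite row0; set x := row k _.
have xA : x *m aug Q = 0 by rewrite -row_mul mulmx_ker row0.
clearbody x.
have := aug_qform x Qs; rewrite xA mul0mx mxE => /esym/eqP.
rewrite psumr_eq0 => [|e _]; last by rewrite mulr_ge0 ?edge_weight_ge0 ?sqr_ge0.
move=> /allP xb; have {}xb e : edge_weight Q e * ((b e *m x^T) 0 0) ^+ 2 = 0.
  by apply/eqP; have := xb e; rewrite mem_index_enum => /(_ isT).
have xlt (i j : 'I_d) : (i < j)%N -> Q i j != 0 -> x 0 i = x 0 j.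
  move=> ij Qij; have /eqP := xb (Some (i, j)); rewrite edge_vec_mul/= ij.
  by rewrite mulf_eq0 (negbTE Qij)/= expf_eq0/= subr_eq0 => /eqP.
have xC : forall i j, x 0 i = x 0 j.
  apply: (connected_const Qcon) => i j /andP[ij Qij].
  have [|ji|/val_inj ij'] := ltngtP i j; first by move/xlt; exact.
    by apply/esym/xlt => //; rewrite -Qs.1 mxE.
  by rewrite ij' eqxx in ij.
have /eqP := xb None; rewrite /= mul1r expf_eq0/=.
apply: contraTeq => /rV0Pn[i xi]; rewrite mxE.
rewrite (eq_bigr (fun=> x 0 i)) => [|j _]; last by rewrite !mxE mul1r (xC j i).
by rewrite sumr_const card_ord mulrn_eq0 negb_or xi andbT -lt0n (leq_ltn_trans _ (ltn_ord i)).
Qed.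

End Aug.

(** * Connected and acyclic edge sets *)

Section TreeGraphs.
Variable d : nat.
Implicit Types (T : {set 'I_d * 'I_d}) (e : 'I_d * 'I_d).

Definition oriented T := forall i j, (i, j) \in T -> (i < j)%N.

Lemma edge_rel_sym T : symmetric (edge_rel T).
Proof. by move=> i j; rewrite /edge_rel orbC. Qed.

Lemma edge_rel_sub T T' : T \subset T' -> subrel (edge_rel T) (edge_rel T').
Proof. by move=> /fintype.subsetP TT' i j /orP[]/TT' ?; apply/orP; [left | right]. Qed.

Lemma connected_edgeS T T' : T \subset T' ->
  connected_graph (edge_rel T) -> connected_graph (edge_rel T').
Proof.
move=> TT' Tcon i j; apply: (connect_sub _ (Tcon i j)) => k l kl.
by apply: connect1; exact: edge_rel_sub kl.
Qed.

Lemma connectedD1 T e : connected_graph (edge_rel T) ->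
  connect (edge_rel (T :\ e)) e.1 e.2 -> connected_graph (edge_rel (T :\ e)).
Proof.
move=> Tcon ce i j; apply: (connect_sub _ (Tcon i j)) => k l kl.
have ce' : connect (edge_rel (T :\ e)) e.2 e.1.
  by rewrite (sym_connect_sym (@edge_rel_sym _)).
have [ekl|ekl] := eqVneq (k, l) e; first by move: ce; rewrite -ekl.
have [elk|elk] := eqVneq (l, k) e; first by move: ce'; rewrite -elk.
by apply: connect1; rewrite /edge_rel !inE ekl elk.
Qed.

(** A path avoiding [e] between its ends, made simple, would close up with [e] to a cycle; the
    orientation of [T] rules out a path of length at most one. *)
Lemma acyclic_bridge T e : oriented T -> acyclic_graph (edge_rel T) ->
  e \in T -> ~ connected_graph (edge_rel (T :\ e)).
Proof.
case: e => x y To Tac xyT con; have xy := To _ _ xyT.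
have /connectP[p0 p0P yl] := con x y.
case/shortenP: p0P yl => p pP pU _ yl.
have sub : subrel (edge_rel (T :\ (x, y))) (edge_rel T).
  by apply: edge_rel_sub; rewrite subD1set.
have /Tac : ucycle (edge_rel T) (x :: p).
  rewrite /ucycle pU andbT /= rcons_path (sub_path sub)//= -yl.
  by rewrite /edge_rel xyT orbT.
case: p pP yl {pU} => [_ /= yx|z [|//] /= /andP[xz _] yz _].
  by rewrite yx ltnn in xy.
move: xz; rewrite -yz /edge_rel !inE eqxx/= => /andP[_ /To yx].
by have := ltn_trans xy yx; rewrite ltnn.
Qed.

(** The rest of the cycle is a detour around its first edge. *)
Lemma cycle_edge_removable T p : oriented T -> connected_graph (edge_rel T) ->
  ucycle (edge_rel T) p -> (2 < size p)%N ->
  exists2 e, e \in T & connected_graph (edge_rel (T :\ e)).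
Proof.
move=> To Tcon; case: p => [//|x [//|y [//|z q]]] /andP[pc pU] _.
move: pc => /= /and3P[xy yz zq].
have con (e : 'I_d * 'I_d) : e = (x, y) \/ e = (y, x) ->
    connect (edge_rel (T :\ e)) y x.
  move=> exy.
  have step k l : edge_rel T k l -> (k != y) || (l != x) ->
      (k != x) || (l != y) -> edge_rel (T :\ e) k l.
    by case: exy => -> /orP[]kl; rewrite /edge_rel !inE kl !xpair_eqE !andbT
      !negb_and => kl1 kl2; rewrite ?kl1 ?kl2 ?orbT// orbC [X in X || _]orbC ?kl1 ?kl2 ?orbT.
  move: pU; rewrite /= !inE !negb_or => /and4P[/and3P[nxy nxz xq] /andP[nyz yq] _ _].
  apply/connectP; exists (z :: rcons q x); last by rewrite /= last_rcons.
  rewrite /= step//= ?[z == x]eq_sym ?nxz ?orbT// 1?eq_sym ?nxy//.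
  apply: (@sub_in_path _ [pred k | k != y] (edge_rel T)) zq.
    by move=> k l; rewrite !inE => ky ly kl; rewrite step// ?ky ?ly ?orbT.
  rewrite /= eq_sym nyz all_rcons/= nxy/=; apply/allP => k kq /=.
  by apply: contraNneq yq => <-.
have := xy; rewrite /edge_rel => /orP[]eT.
  exists (x, y) => //; apply: connectedD1 => //.
  by rewrite (sym_connect_sym (@edge_rel_sym _)); apply: con; left.
by exists (y, x) => //; apply: connectedD1 => //; apply: con; right.
Qed.

End TreeGraphs.

Lemma edge_vec_intr (R : nzRingType) (d : nat) (e : option ('I_d * 'I_d)) :
  edge_vec R d e = map_mx intr (edge_vec int d e).
Proof. by case: e => [[i j]|]; apply/rowP => k; rewrite !mxE ?rmorphB ?rmorph_nat. Qed.

(** * Spanning trees as the nonzero terms of the determinant *)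

Section MatrixTree.
Variables (R : realType) (d : nat).
Hypothesis d_gt0 : (0 < d)%N.
Local Notation edge := (option ('I_d * 'I_d)).
Local Notation b := (edge_vec R d).
Implicit Types (U : {set edge}) (T : {set 'I_d * 'I_d}) (f : 'I_d -> edge).

Let edge_mx (F : nzRingType) f : 'M[F]_d := \matrix_i edge_vec F d (f i).

Let with_ones T : {set edge} := None |: Some @: T.

Let edges U : {set 'I_d * 'I_d} := Some @^-1: U.

Lemma with_onesK : cancel with_ones edges.
Proof.
move=> T; apply/setP => e; rewrite !inE/=.
by apply/imsetP/idP => [[? ? [->]]//|eT]; exists e.
Qed.

Lemma edgesK U : None \in U -> with_ones (edges U) = U.
Proof.
move=> NU; apply/setP => -[e|]; rewrite !inE//=.
by apply/imsetP/idP => [[e' + [->]]|eU]; [rewrite inE | exists e; rewrite ?inE].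
Qed.

(** An invertible matrix annihilates no nonzero vector: without the index [None] it would annihilate
    the all-ones vector, and for a disconnected graph the centered indicator of a component. *)
Lemma edge_mx_connected f : injective f -> edge_mx R f \in unitmx ->
  (exists i, f i = None) /\
  connected_graph (edge_rel (edges (f @: [set: 'I_d])%SET)).
Proof.
move=> finj Mu.
have Minj (x : 'rV_d) : (forall i, (b (f i) *m x^T) 0 0 = 0) -> x = 0.
  move=> fx; apply: trmx_inj; rewrite trmx0 -[LHS](mulKmx Mu).
  rewrite (_ : edge_mx R f *m x^T = 0) ?mulmx0//.
  apply/colP => i; rewrite [RHS]mxE -[RHS](fx i) !mxE.
  by apply: eq_bigr => k _; rewrite !mxE.
have fN : exists i, f i = None.
  apply: contrapT => fN.
  have /rowP/(_ (Ordinal d_gt0)) : (const_mx 1 : 'rV[R]_d) = 0.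
    apply: Minj => i; case fi: (f i) => [[k l]|]; last by case: fN; exists i.
    by rewrite edge_vec_mul !mxE subrr.
  by rewrite !mxE => /eqP; rewrite oner_eq0.
split=> // k l; set e := edge_rel _.
pose s := \sum_i (connect e k i)%:R : R.
(* Scaling by [d] and subtracting [s] makes the coordinates sum to zero, so that the row of index
   [None] vanishes on [x] too. *)
pose x : 'rV[R]_d := \row_i ((connect e k i)%:R *+ d - s).
have x0 : x = 0.
  apply: Minj => i; case fi : (f i) => [[j m]|].
    have jm : connect e j m.
      by apply: connect1; rewrite /e /edge_rel inE -fi imset_f ?inE.
    rewrite edge_vec_mul !mxE (same_connect_r _ jm) ?subrr//.
    exact: (sym_connect_sym (@edge_rel_sym _ _)).
  rewrite mxE; under eq_bigr do rewrite !mxE mul1r.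
  by rewrite sumrB sumr_const card_ord -sumrMnl subrr.
have /rowP/(_ k) := x0; have /rowP/(_ l) := x0; rewrite !mxE connect0.
move=> <- /eqP; rewrite (inj_eq (addIr _)) eqr_pMn2r// eqr_nat eq_sym.
by case: connect.
Qed.

(** Along a path from [k] to [l] the vector of [(k, l)] telescopes into signed edge vectors of the
    graph, so integer coefficients suffice. *)
Lemma edge_lattice f : (exists i, f i = None) ->
  connected_graph (edge_rel (edges (f @: [set: 'I_d])%SET)) ->
  forall e, exists u : 'rV[int]_d, edge_vec int d e = u *m edge_mx int f.
Proof.
move=> [i0 fi0] fcon; pose spanned v := exists u : 'rV[int]_d, v = u *m edge_mx int f.
have f_spanned i : spanned (edge_vec int d (f i)).
  by exists (delta_mx 0 i); rewrite -rowE rowK.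
have spannedD v v' : spanned v -> spanned v' -> spanned (v + v').
  by move=> [u ->] [u' ->]; exists (u + u'); rewrite mulmxDl.
case=> [[k l]|]; last by rewrite -fi0; exact: f_spanned.
have /connectP[p] := fcon k l.
elim: p k => [|m p IHp] k /= => [_ ->|/andP[km mp] lp].
  by exists 0; rewrite /= subrr mul0mx.
rewrite -(subrKA (delta_mx 0 m)); apply: spannedD; last exact: IHp.
move: km; rewrite /edge_rel !inE => /orP[]/imsetP[i _ fi].
  by have := f_spanned i; rewrite -fi.
by have [u] := f_spanned i; rewrite -fi /= => uE; exists (- u); rewrite mulNmx -uE opprB.
Qed.

(* The edge vectors of a connected graph, together with the all-ones vector,
   generate the same integer lattice whatever the graph, so the two matrices
   differ by an integer factor. *)
Lemma sqr_det_edge_mx_le f f' : injective f -> injective f' ->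
  edge_mx R f \in unitmx -> edge_mx R f' \in unitmx ->
  \det (edge_mx R f) ^+ 2 <= \det (edge_mx R f') ^+ 2.
Proof.
move=> finj finj' Mu Mu'; have [fN fcon] := edge_mx_connected finj Mu.
have /fin_all_exists[u uE] i := edge_lattice fN fcon (f' i).
pose C := \matrix_i u i.
have ME g : edge_mx R g = map_mx intr (edge_mx int g).
  by apply/row_matrixP => i; rewrite -map_row !rowK edge_vec_intr.
have M'E : edge_mx R f' = map_mx intr C *m edge_mx R f.
  rewrite !ME -map_mxM; congr map_mx; apply/row_matrixP => i.
  by rewrite row_mul !rowK.
move: Mu'; rewrite M'E unitmxE det_mulmx unitfE mulf_eq0 negb_or => /andP[C0 _].
rewrite exprMn ler_peMl ?sqr_ge0//.
(* A nonzero integer has square at least one. *)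
move: C0; rewrite det_map_mx intr_eq0 -rmorphXn/= -sqrf_eq0 => C0.
by rewrite ler1z -gtz0_ge1 lt_neqAle sqr_ge0 eq_sym C0.
Qed.

(* The constant is [d ^ 2], but only its positivity matters. *)
Lemma matrix_tree : exists2 kappa : R, 0 < kappa &
  forall Q : 'M[R]_d, sym0 Q -> \det (aug Q) = kappa * tree_poly Q.
Proof.
have [c cE [c0 c_img]] := det_weighted_gram b.
have detE (Q : 'M[R]_d) : sym0 Q ->
    \det (aug Q) = \sum_(U : {set edge}) (\prod_(e in U) edge_weight Q e) * c U.
  by move=> /aug_edge_sum->.
have cP U : c U != 0 -> exists2 f, injective f /\ edge_mx R f \in unitmx &
    U = (f @: [set: 'I_d])%SET.
  move=> cU; have cardU : #|U| = d.
    by apply/eqP; apply: contraNT cU => /c0->.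
  pose f i := enum_val (cast_ord (esym cardU) i).
  have finj : injective f by move=> i j /enum_val_inj/cast_ord_inj.
  have UE : U = (f @: [set: 'I_d])%SET.
    apply/esym/eqP; rewrite eqEcard card_imset// cardU cardsT card_ord leqnn andbT.
    by apply/fintype.subsetP => e /imsetP[i _ ->]; exact: enum_valP.
  exists f => //; split=> //; rewrite unitmxE unitfE -sqrf_eq0.
  by rewrite -[_ ^+ 2]c_img// -UE.
have c_edges U : c U != 0 ->
    [/\ None \in U, connected_graph (edge_rel (edges U)) & #|U| = d].
  move=> /[dup] cU /cP[f [finj Mu] UE].
  have [[i fi] fcon] := edge_mx_connected finj Mu; rewrite UE; split=> //.
    by rewrite -fi imset_f ?inE.
  by rewrite card_imset// cardsT card_ord.
have c_const U V : c U != 0 -> c V != 0 -> c U = c V.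
  move=> /cP[f [finj Mu] ->] /cP[g [ginj Nu] ->]; rewrite !c_img//.
  by apply/eqP; rewrite eq_le !sqr_det_edge_mx_le.
have c_gt0 U : c U != 0 -> 0 < c U.
  by move=> /[dup] cU /cP[f [finj _] UE]; rewrite lt_neqAle eq_sym cU UE c_img// sqr_ge0.
(* The 0/1 weights of a connected [T] give an invertible augmented Laplacian, so some term of the
   expansion is nonzero, and such a term uses no edge of weight zero. *)
have subtree T : oriented T -> connected_graph (edge_rel T) ->
    exists2 U : {set edge}, U \subset with_ones T & c U != 0.
  move=> To Tcon; pose Q : 'M[R]_d := \matrix_(i, j) (edge_rel T i j)%:R.
  have Tirr i : edge_rel T i i = false.
    by apply: contraTF isT => /orP[]/To; rewrite ltnn.
  have Qs : sym0 Q.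
    by split=> [|i]; [apply/matrixP => i j|]; rewrite !mxE ?Tirr// edge_rel_sym.
  have : \det (aug Q) != 0.
    rewrite -unitfE -unitmxE; apply: aug_unit; split=> // [i j|i j].
      by rewrite mxE ler0n.
    apply: (connect_sub _ (Tcon i j)) => k l kl; apply: connect1.
    rewrite /support_graph mxE kl oner_eq0 andbT.
    by apply: contraTneq kl => ->; rewrite Tirr.
  rewrite detE// => /eqP dQ; apply: contrapT => noU; apply: dQ.
  apply: big1 => U _; have [->|cU] := eqVneq (c U) 0; first by rewrite mulr0.
  have /subsetPn[e eU eT] : ~~ (U \subset with_ones T).
    by apply/negP => UT; apply: noU; exists U.
  suff w0 : edge_weight Q e = 0 by rewrite (bigD1 e)//= w0 !mul0r.
  case: e eT {eU} => [[i j]|]; last by rewrite !inE.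
  rewrite !inE/= => /imsetP eT; case: ifP => // ij.
  rewrite mxE; have [/orP[ijT|/To]|_] := boolP (edge_rel T i j); last by [].
    by case: eT; exists (i, j).
  by move=> /(ltn_trans ij); rewrite ltnn.
have cardT T : #|with_ones T| = #|T|.+1.
  rewrite cardsU1 card_imset; last by move=> ? ? [].
  by rewrite (_ : _ \notin _)//; apply/imsetP => -[].
(* A connected graph contains the edge set of a nonzero term of the expansion,
   and these all have [d - 1] edges; so the nonzero terms are the minimally
   connected graphs. *)
have treeP T : oriented T -> reflect (spanning_tree T) (c (with_ones T) != 0).
  move=> To; apply: (iffP idP) => [cT|[_ Tcon Tac]].
    have [_ Tcon cardTd] := c_edges _ cT; rewrite with_onesK in Tcon.
    split=> // p pT; rewrite leqNgt; apply/negP => p2.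
    have [e eT Tecon] := cycle_edge_removable To Tcon pT p2.
    have Teo : oriented (T :\ e) by move=> i j; rewrite inE => /andP[_ /To].
    have [U UTe cU] := subtree _ Teo Tecon.
    have [_ _ cardU] := c_edges _ cU.
    have := subset_leq_card UTe.
    rewrite cardT (_ : #|U| = #|T|.+1); last by rewrite -cardT cardTd.
    by rewrite (cardsD1 e T) eT ltnn.
  have [U UT cU] := subtree _ To Tcon; have [NU Ucon _] := c_edges _ cU.
  have {}UT : edges U \subset T by rewrite -[T]with_onesK; exact: preimsetS.
  suff <- : edges U = T by rewrite edgesK.
  apply/eqP; rewrite finset.eqEsubset UT; apply/fintype.subsetP => e eT.
  apply: contrapT => eU; apply: (acyclic_bridge To Tac eT).
  apply: (connected_edgeS _ Ucon); apply/fintype.subsetP => e' e'U; rewrite !inE.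
  rewrite (fintype.subsetP UT)// andbT.
  by apply: contraPneq e'U => ->.
(* The complete graph supplies one nonzero coefficient, which serves as the common value of all of
   them. *)
pose K : {set 'I_d * 'I_d} := [set e : 'I_d * 'I_d | (e.1 < e.2)%N]%SET.
have Ko : oriented K by move=> i j; rewrite inE.
have [U0 _ cU0] : exists2 U : {set edge}, U \subset with_ones K & c U != 0.
  apply: subtree => // i j; have [->|ij] := eqVneq i j; first exact: connect0.
  by apply: connect1; rewrite /edge_rel !inE/= -neq_ltn.
exists (c U0); first exact: c_gt0.
move=> Q Qs; rewrite detE// (bigID (fun U => None \in U))/=.
rewrite [X in _ + X]big1 ?addr0; last first.
  by move=> U; have [->|/c_edges[->//]] := eqVneq (c U) 0; rewrite mulr0.
rewrite (reindex_onto with_ones edges)/=; last exact: edgesK.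
rewrite /tree_poly mulr_sumr [RHS]big_mkcond/=; apply: eq_big => [T|T _].
  by rewrite with_onesK eqxx !inE.
have prodE : \prod_(e in with_ones T) edge_weight Q e =
    \prod_(ij in T) edge_weight Q (Some ij).
  rewrite big_setU1/=; last by apply/imsetP => -[].
  by rewrite mul1r big_imset//= => ? ? _ _ [].
rewrite prodE; have [To|/existsNP[i /existsNP[j /not_implyP[ijT ij]]]] := pselect (oriented T).
  case: asboolP => Tt.
    have cT : c (with_ones T) != 0 by exact/treeP.
    rewrite mulrC (c_const _ _ cT cU0); congr (_ * _).
    by apply: eq_bigr => -[i j] /To /= ->.
  have /eqP -> : c (with_ones T) == 0 by apply: contra_notT Tt => /treeP; exact.
  by rewrite mulr0.
(* A set with a badly oriented pair is no spanning tree, and its product contains a zero edge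
   weight. *)
case: asboolP => [[/(_ _ _ ijT)]//|_].
by rewrite (bigD1 (i, j))//=; case: ifP ij => // _ _; rewrite !mul0r.
Qed.

End MatrixTree.

(** * Optimality conditions *)

(** Two block eliminations of [B] yield the two sides. *)
Lemma det1_add_mul (F : comNzRingType) (n : nat) (u : 'cV[F]_n) (v : 'rV[F]_n) :
  \det (1%:M + u *m v) = 1 + (v *m u) 0 0.
Proof.
pose B := block_mx 1%:M (- v) u 1%:M.
have E1 : block_mx 1%:M 0 (- u) 1%:M *m B = block_mx 1%:M (- v) 0 (1%:M + u *m v).
  rewrite mulmx_block !mul1mx !mul0mx !mulNmx mulmxN !addr0 mulmx1 opprK.
  by rewrite addNr addrC.
have E2 : block_mx 1%:M v 0 1%:M *m B = block_mx (1%:M + v *m u) 0 u 1%:M.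
  by rewrite mulmx_block !mul1mx !mul0mx mulmx1 !add0r addNr.
have := congr1 determinant E1; have := congr1 determinant E2.
rewrite !det_mulmx !det_lblock !det_ublock !det1 !mul1r mulr1 => -> <-.
by rewrite det_mx11 !mxE.
Qed.

Lemma det_add_rank1 (F : fieldType) (n : nat) (A : 'M[F]_n) (v : 'rV[F]_n) t :
  A \in unitmx ->
  \det (A + t *: (v^T *m v)) = \det A * (1 + t * (v *m invmx A *m v^T) 0 0).
Proof.
move=> Au.
have -> : A + t *: (v^T *m v) = A *m (1%:M + (t *: (invmx A *m v^T)) *m v).
  by rewrite mulmxDr mulmx1 -!scalemxAl -scalemxAr -!mulmxA mulKVmx.
by rewrite det_mulmx det1_add_mul -scalemxAr mulmxA mxE.
Qed.

Lemma le_add_smallmul (R : realFieldType) (x y z t0 : R) : 0 < t0 ->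
  (forall t, 0 < t < t0 -> x <= y + t * z) -> x <= y.
Proof.
move=> t0_gt0 xyz; apply/ler_addgt0Pr => e e0.
(* The second bound makes [t * z] at most [e]; adding 1 keeps the denominator positive. *)
pose t := Num.min (t0 / 2) (e / (`|z| + 1)).
have z1 : 0 < `|z| + 1 by rewrite ltr_wpDl.
have tt0 : 0 < t < t0.
  by rewrite lt_min gt_min !divr_gt0//= ltr_pdivrMr// ltr_pMr// ltr1n.
apply: (le_trans (xyz _ tt0)); rewrite lerD2l.
have te : t <= e / (`|z| + 1) by rewrite ge_min lexx orbT.
case/andP: tt0 => tgt0 _.
apply: (@le_trans _ _ (t * (`|z| + 1))); last by rewrite -ler_pdivlMr.
by rewrite ler_pM2l// (le_trans (ler_norm z))// lerDl.
Qed.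

(** * First-order conditions at a maximizer *)

Section KKT.
Variables (R : realType) (d : nat).
Implicit Types (Q G : 'M[R]_d) (i j : 'I_d).
Local Notation b := (edge_vec R d).

Definition resistance Q i j : R :=
  (b (Some (i, j)) *m invmx (aug Q) *m (b (Some (i, j)))^T) 0 0.

(* The Karush-Kuhn-Tucker conditions for maximizing [loglik] over [Uplus]: the
   gradient of [ln (tree_poly Q)] is the matrix of effective resistances. *)
Definition KKT G Q := Uplus Q /\ forall i j, (i < j)%N ->
  resistance Q i j <= G i j /\ (Q i j != 0 -> resistance Q i j = G i j).

Lemma tree_poly_gt0 Q : (0 < d)%N -> Uplus Q -> 0 < tree_poly Q.
Proof.
move=> d_gt0 QU; have [kappa k0 kE] := matrix_tree R d_gt0.
rewrite lt_neqAle; apply/andP; split.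
  have := aug_unit QU; rewrite unitmxE unitfE kE; last by case: QU.
  by rewrite mulf_eq0 negb_or => /andP[_]; rewrite eq_sym.
by apply: sumr_ge0 => T _; apply: prodr_ge0 => e _; case: QU.
Qed.

Definition bump_edge Q i j (t : R) : 'M[R]_d :=
  Q + t *: (delta_mx i j + delta_mx j i).

Lemma bump_edgeE Q i j t k l : bump_edge Q i j t k l =
  Q k l + t * (((k == i) && (l == j))%:R + ((k == j) && (l == i))%:R).
Proof. by rewrite !mxE. Qed.

Lemma bump_edge_sym0 Q i j t : i != j -> sym0 Q -> sym0 (bump_edge Q i j t).
Proof.
move=> ij [Qt Q0]; split=> [|k].
  apply/matrixP => k l; rewrite mxE !bump_edgeE -{1}Qt mxE.
  by rewrite [_ && (k == j)]andbC [_ && (k == i)]andbC addrC addrC [X in _ + _ * X]addrC.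
rewrite bump_edgeE Q0 add0r; case: eqVneq => [->|_]; rewrite ?(negbTE ij) /=.
  by rewrite addr0 mulr0.
by rewrite andbF addr0 mulr0.
Qed.

Lemma bump_edge_Uplus Q i j t : i != j -> Uplus Q -> 0 < Q i j + t ->
  Uplus (bump_edge Q i j t).
Proof.
move=> ij [Qs Q0 Qcon] Qt.
have QC : Q j i = Q i j by rewrite -{1}Qs.1 mxE.
have bumpP k l : bump_edge Q i j t k l = Q k l \/ bump_edge Q i j t k l = Q i j + t.
  rewrite bump_edgeE; have [->/=|ki] := eqVneq k i.
    rewrite (negbTE ij) /=; have [->|_] := eqVneq l j; [right|left].
      by rewrite addr0 mulr1.
    by rewrite addr0 mulr0 addr0.
  rewrite add0r; have [->|_] := eqVneq k j; last by left; rewrite mulr0 addr0.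
  have [->|_] := eqVneq l i; last by left; rewrite mulr0 addr0.
  by right; rewrite mulr1 QC.
split; first exact: bump_edge_sym0.
  by move=> k l; case: (bumpP k l) => ->//; rewrite ltW.
move=> k l; apply: (connect_sub _ (Qcon k l)) => k' l' /andP[kl Qkl].
apply: connect1; rewrite /support_graph kl /=.
by case: (bumpP k' l') => ->//; rewrite gt_eqF.
Qed.

Lemma aug_bump_edge Q i j t : (i < j)%N -> sym0 Q ->
  aug (bump_edge Q i j t) = aug Q + t *: ((b (Some (i, j)))^T *m b (Some (i, j))).
Proof.
move=> ij Qs; have nij : i != j by apply: contraTneq ij => ->; rewrite ltnn.
rewrite !aug_edge_sum//; last exact: bump_edge_sym0.
rewrite (bigD1 (Some (i, j)))//= [in RHS](bigD1 (Some (i, j)))//=.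
rewrite addrAC ij bump_edgeE !eqxx (negbTE nij) addr0 mulr1 -scalerDl; congr (_ + _).
apply: eq_bigr => -[[k l]|//] /= kl; congr (_ *: _); case: ifP => // kl'.
rewrite bump_edgeE; rewrite -[_ && _]/((k, l) == (i, j)).
have /negbTE -> : (k, l) != (i, j) by apply: contraNneq kl => ->.
have [kj|_] /= := eqVneq k j; last by rewrite addr0 mulr0 addr0.
have [li|_] := eqVneq l i; last by rewrite addr0 mulr0 addr0.
by move: kl'; rewrite li kj => /(ltn_trans ij); rewrite ltnn.
Qed.

Lemma mxdot_bump_edge G Q i j t : (i < j)%N ->
  mxdot G (bump_edge Q i j t) = mxdot G Q + t * G i j.
Proof.
move=> ij; apply/eqP; rewrite addrC -subr_eq; apply/eqP.
rewrite /mxdot -sumrB (bigD1 i)//= [X in _ + X]big1 ?addr0 => [|k ki]; last first.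
  rewrite -sumrB big1// => l kl; rewrite bump_edgeE (negbTE ki) add0r.
  have [kj|_] /= := eqVneq k j; last by rewrite mulr0 addr0 subrr.
  have [li|_] := eqVneq l i; last by rewrite mulr0 addr0 subrr.
  by move: kl; rewrite li kj => /(ltn_trans ij); rewrite ltnn.
have /negbTE nij : i != j by apply: contraTneq ij => ->; rewrite ltnn.
rewrite -sumrB (bigD1 j)//= [X in _ + X]big1 ?addr0 => [|l /andP[il lj]].
  by rewrite bump_edgeE !eqxx nij addr0 mulr1; ring.
by rewrite bump_edgeE (negbTE lj) nij andbF addr0 mulr0 addr0 subrr.
Qed.

(** Changing one weight by [t] multiplies the tree polynomial by [1 + t * r], so maximality reads
    [ln (1 + t * r) <= t * G i j]. Either sign of [t] is allowed. *)
Lemma argmax_resistance_le G Q i j t : (0 < d)%N ->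
  is_argmax (@Uplus R d) (fun Q => loglik Q G) Q -> (i < j)%N -> 0 < Q i j + t ->
  t * resistance Q i j <= t * G i j * (1 + t * resistance Q i j).
Proof.
move=> d_gt0 [QU Qmax] ij Qt; set r := resistance Q i j.
have nij : i != j by apply: contraTneq ij => ->; rewrite ltnn.
have Q'U : Uplus (bump_edge Q i j t) by exact: bump_edge_Uplus.
have [kappa k0 kE] := matrix_tree R d_gt0.
have Qs : sym0 Q by case: QU.
have Q'E : tree_poly (bump_edge Q i j t) = tree_poly Q * (1 + t * r).
  apply: (mulfI (lt0r_neq0 k0)); rewrite -kE; last by case: Q'U.
  by rewrite aug_bump_edge// det_add_rank1 ?aug_unit// mulrA -kE.
have Q0 := tree_poly_gt0 d_gt0 QU.
have r0 : 0 < 1 + t * r.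
  by have := tree_poly_gt0 d_gt0 Q'U; rewrite Q'E pmulr_rgt0.
have := Qmax _ Q'U; rewrite /loglik Q'E lnM ?posrE// mxdot_bump_edge// => lnle.
have {}lnle : ln (1 + t * r) <= t * G i j by lra.
rewrite -ler_pdivrMr//; apply: le_trans lnle.
(* This amounts to [ln y >= 1 - y^-1] at [y = 1 + t * r]. *)
have : ln (1 + ((1 + t * r)^-1 - 1)) <= (1 + t * r)^-1 - 1.
  by apply: le_ln1Dx; rewrite ltrBrDl subrr invr_gt0.
rewrite addrC subrK lnV ?posrE// lerNl; apply: le_trans.
rewrite le_eqVlt; apply/orP; left; apply/eqP; field.
exact: lt0r_neq0.
Qed.

(** Letting [t] decrease to zero gives the inequality; on the support small negative changes are
    admissible too and give the reverse one. *)
Lemma argmax_KKT G Q : (0 < d)%N ->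
  is_argmax (@Uplus R d) (fun Q => loglik Q G) Q -> KKT G Q.
Proof.
move=> d_gt0 /[dup] Qam [QU _]; split=> // i j ij.
have Q0 : 0 <= Q i j by case: QU.
set r := resistance Q i j.
have rle : r <= G i j.
  apply: (@le_add_smallmul _ _ _ (G i j * r) 1) => // t /andP[t0 _].
  have := argmax_resistance_le d_gt0 Qam ij (ltr_wpDl Q0 t0).
  by rewrite -mulrA ler_pM2l// mulrDr mulr1 mulrCA.
split=> // Qij; apply/eqP; rewrite eq_le rle /=.
have {}Q0 : 0 < Q i j by rewrite lt_neqAle eq_sym Qij.
apply: (@le_add_smallmul _ _ _ (G i j * r) (Q i j)) => // t /andP[t0 tQ].
have Qt : 0 < Q i j + - t by rewrite subr_gt0.
have := argmax_resistance_le d_gt0 Qam ij Qt; rewrite -/r => H.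
by rewrite -(ler_pM2l t0); lra.
Qed.

End KKT.

(** * The optimality conditions at the true parameter *)

Section TrueParameter.
Variables (R : realType) (d : nat) (Gam : 'M[R]_d).
Hypotheses (d_gt0 : (0 < d)%N) (Gam_negdef : cond_negdef Gam).
Local Notation P := (centering R d).
Local Notation one := (ones R d).
Local Notation b := (edge_vec R d).
Local Notation Theta := (HR_precision Gam).

Let S := P *m (- 2^-1 *: Gam) *m P.

Let d_neq0 : d%:R != 0 :> R. Proof. by rewrite pnatr_eq0 -lt0n. Qed.

Let one_dot : one^T *m one = d%:R%:M.
Proof.
apply/matrixP => i j; rewrite !ord1 !mxE eqxx mulr1n.
under eq_bigr do rewrite !mxE mulr1.
by rewrite sumr_const card_ord.
Qed.

Lemma centering_tr : P^T = P.
Proof. by rewrite linearB linearZ /= trmx_mul trmxK trmx1. Qed.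

Lemma one_centering : one^T *m P = 0.
Proof.
rewrite mulmxBr mulmx1 -scalemxAr mulmxA one_dot mul_scalar_mx scalerA.
by rewrite mulVf// scale1r subrr.
Qed.

Lemma centering_id (n : nat) (v : 'M[R]_(d, n)) : one^T *m v = 0 -> P *m v = v.
Proof. by move=> v1; rewrite mulmxBl mul1mx -scalemxAl -mulmxA v1 mulmx0 scaler0 subr0. Qed.

Lemma centering_idem : P *m P = P.
Proof. exact: centering_id one_centering. Qed.

Let S_tr : S^T = S.
Proof. by rewrite !trmx_mul centering_tr linearZ /= Gam_negdef.1.1 mulmxA. Qed.

Let one_S : one^T *m S = 0. Proof. by rewrite !mulmxA one_centering !mul0mx. Qed.

(** On vectors of zero sum the form of [S] is [- 2^-1] times that of [Gam], hence definite. *)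
Let S_inj (v : 'cV[R]_d) : S *m v = 0 -> one^T *m v = 0 -> v = 0.
Proof.
move=> Sv v1; apply/eqP; apply: contraT => v0.
have v1' : v^T *m one = 0 by apply: trmx_inj; rewrite trmx_mul trmxK v1 trmx0.
have := Gam_negdef.2 v v0 v1'; suff -> : v^T *m Gam *m v = 0 by rewrite mxE ltxx.
have := congr1 (mulmx v^T) Sv; rewrite mulmx0 /S !mulmxA -!(mulmxA _ P v).
have -> : v^T *m P = v^T by rewrite -[in RHS](centering_id v1) trmx_mul centering_tr.
rewrite centering_id// -scalemxAr -scalemxAl => /eqP.
by rewrite scaler_eq0 oppr_eq0 invr_eq0 pnatr_eq0 /= => /eqP.
Qed.

Let Theta_tr : Theta^T = Theta.
Proof.
have [STS TST STt TSt] := moore_penroseP S.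
apply: (@is_moore_penrose_uniq _ _ _ S) (moore_penroseP S).
rewrite /HR_precision -/S; set T := moore_penrose S in STS TST STt TSt *; split.
- by rewrite -{1 2}S_tr -!trmx_mul mulmxA STS S_tr.
- by rewrite -{1}S_tr -!trmx_mul mulmxA TST.
- by rewrite -S_tr -trmx_mul TSt.
- by rewrite -S_tr -trmx_mul STt.
Qed.

Let one_Theta : one^T *m Theta = 0.
Proof.
have [_ TST _ TSt] := moore_penroseP S.
by rewrite /HR_precision -/S -TST -TSt trmx_mul S_tr -(mulmxA S) mulmxA one_S mul0mx.
Qed.

(** The columns of the difference have zero sum and are annihilated by [S], so [S_inj] applies. *)
Let Theta_S : Theta *m S = P.
Proof.
have [STS _ _ _] := moore_penroseP S.
apply/eqP; rewrite -subr_eq0; apply/eqP/matrixP => i j.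
suff /matrixP/(_ i 0) : col j (Theta *m S - P) = 0 by rewrite !mxE.
have S_P : S *m P = S by rewrite /S -mulmxA centering_idem.
apply: S_inj; rewrite colE mulmxA.
  by rewrite mulmxBr mulmxA STS S_P subrr mul0mx.
by rewrite mulmxBr mulmxA one_Theta mul0mx one_centering subrr mul0mx.
Qed.

Let S_Theta : S *m Theta = P.
Proof. by apply: trmx_inj; rewrite trmx_mul S_tr Theta_tr Theta_S centering_tr. Qed.

Definition precision_weights : 'M[R]_d :=
  \matrix_(i, j) (if i == j then 0 else - Theta i j).

Lemma sum_precision i : \sum_j Theta i j = 0.
Proof.
have := congr1 trmx one_Theta; rewrite trmx_mul trmxK Theta_tr trmx0.
move=> /colP/(_ i); rewrite mxE [RHS]mxE => T1; rewrite -[RHS]T1.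
by apply: eq_bigr => j _; rewrite mxE mulr1.
Qed.

Lemma laplacian_precision_weights : laplacian precision_weights = Theta.
Proof.
apply/matrixP => i j; rewrite !mxE; case: eqVneq => [<-|_]; last by rewrite opprK.
have := sum_precision i; rewrite (bigD1 i)//= => /eqP; rewrite addr_eq0 => /eqP ->.
by rewrite -sumrN; apply: eq_bigr => k ki; rewrite mxE eq_sym (negbTE ki).
Qed.

Lemma precision_weights_sym0 : sym0 precision_weights.
Proof.
split=> [|i]; last by rewrite mxE eqxx.
by apply/matrixP => i j; rewrite !mxE eq_sym -{1}Theta_tr mxE.
Qed.

Lemma precision_kernel (x : 'cV[R]_d) : Theta *m x = 0 -> forall i j, x i 0 = x j 0.
Proof.
move=> Tx i j; have Px : P *m x = 0 by rewrite -S_Theta -mulmxA Tx mulmx0.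
have xE : x = d%:R^-1 *: (one *m (one^T *m x)).
  by apply/eqP; rewrite mulmxA scalemxAl -subr_eq0 -{1}[x]mul1mx -mulmxBl Px.
by rewrite xE mxE [RHS]mxE; congr (_ * _); rewrite !mxE !big_ord1 !mxE.
Qed.

(** The support is connected because the indicator of a component lies in the kernel of [Theta],
    which contains only constant vectors. *)
Lemma precision_weights_Uplus : EMTP2 Gam -> Uplus precision_weights.
Proof.
move=> emtp; split; first exact: precision_weights_sym0.
  by move=> i j; rewrite mxE; case: eqVneq => // ij; rewrite oppr_ge0; exact: emtp.
move=> i j; set e := support_graph _; pose x : 'cV[R]_d := \col_k (connect e i k)%:R.
have eS : symmetric e.
  by move=> k l; rewrite /e /support_graph eq_sym -{1}precision_weights_sym0.1 mxE.
have Tx : Theta *m x = 0.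
  apply/colP => k; transitivity ((\sum_l Theta k l) * x k 0); last first.
    by rewrite sum_precision mul0r mxE.
  rewrite mxE mulr_suml; apply: eq_bigr => l _.
  have [->//|kl] := eqVneq k l; have [->|Tkl] := eqVneq (Theta k l) 0.
    by rewrite !mul0r.
  congr (_ * _); rewrite !mxE.
  have ekl : connect e k l.
    by apply: connect1; rewrite /e /support_graph kl mxE (negbTE kl) oppr_eq0.
  by rewrite (same_connect_r (sym_connect_sym eS) ekl).
have := precision_kernel Tx i j; rewrite !mxE connect0.
by case: connect => // /eqP; rewrite oner_eq0.
Qed.

(** On zero-sum edge vectors the inverse of the augmented Laplacian has the same form as [S], whose
    value there is the variogram entry. *)
Lemma resistance_precision_weights i j : resistance precision_weights i j = Gam i j.
Proof.
have b1 : b (Some (i, j)) *m one = 0.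
  by apply/rowP => k; rewrite mulmxBl -!rowE !mxE subrr.
have augE : aug precision_weights = Theta + one *m one^T.
  rewrite /aug laplacian_precision_weights; congr (_ + _).
  by apply/matrixP => k l; rewrite !mxE big_ord1 !mxE mulr1.
(* Since [one^T *m one] is [d], this coefficient turns the product of the two rank-one terms into
   [d^-1] times [one *m one^T], the complement of the centering matrix. *)
have inv : aug precision_weights *m (S + (d%:R ^- 2) *: (one *m one^T)) = 1%:M.
  have Theta_1 : Theta *m one = 0.
    by apply: trmx_inj; rewrite trmx_mul Theta_tr one_Theta trmx0.
  rewrite augE mulmxDl !mulmxDr Theta_S -!scalemxAr mulmxA Theta_1 mul0mx scaler0.
  rewrite addr0 -(mulmxA one _ S) one_S mulmx0 add0r -mulmxA (mulmxA one^T) one_dot.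
  rewrite mul_scalar_mx -scalemxAr scalerA expr2 invfM -mulrA mulVf// mulr1.
  by rewrite subrK.
have [Au _] := mulmx1_unit inv.
have -> : resistance precision_weights i j =
    (b (Some (i, j)) *m S *m (b (Some (i, j)))^T) 0 0.
  rewrite /resistance -[invmx _]mulmx1 -inv mulKmx// mulmxDr -scalemxAr.
  by rewrite (mulmxA _ one) b1 mul0mx scaler0 addr0.
have bP : b (Some (i, j)) *m P = b (Some (i, j)).
  by rewrite mulmxBr mulmx1 -scalemxAr mulmxA b1 mul0mx scaler0 subr0.
have Pb : P *m (b (Some (i, j)))^T = (b (Some (i, j)))^T.
  by rewrite -{1}centering_tr -trmx_mul bP.
rewrite /S !mulmxA bP -mulmxA Pb /edge_vec mulmxBl linearB /= mulmxBr !mulmxBl.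
rewrite -!rowE !trmx_delta -!colE !mxE !Gam_negdef.1.2.
have -> : Gam j i = Gam i j by rewrite -{1}Gam_negdef.1.1 mxE.
by field.
Qed.

Lemma KKT_precision_weights : EMTP2 Gam -> KKT Gam precision_weights.
Proof.
move=> emtp; split; first exact: precision_weights_Uplus.
by move=> i j _; rewrite resistance_precision_weights.
Qed.

(** At the edge vector of [(i, j)] the quadratic form of [Gam] equals [- 2 * Gam i j]. *)
Lemma cond_negdef_pos : pos_offdiag Gam.
Proof.
move=> i j ij; pose v := (b (Some (i, j)))^T.
have v0 : v != 0.
  apply/eqP => /colP/(_ i); rewrite !mxE !eqxx (negbTE ij) subr0 => /eqP.
  by rewrite oner_eq0.
have v1 : v^T *m one = 0.
  by rewrite trmxK; apply/rowP => k; rewrite mulmxBl -!rowE !mxE subrr.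
have := Gam_negdef.2 v v0 v1; rewrite trmxK /v /edge_vec linearB /= mulmxBr !mulmxBl.
rewrite -!rowE !trmx_delta -!colE !mxE !Gam_negdef.1.2.
have -> : Gam j i = Gam i j by rewrite -{1}Gam_negdef.1.1 mxE.
by lra.
Qed.

End TrueParameter.

(** * Stability of the optimality conditions *)

(** Cauchy-Schwarz, from the Lagrange identity: the doubled difference is a double sum of
    squares. *)
Lemma sum_mul_sqr_le (R : realFieldType) (I : finType) (u v : I -> R) :
  (\sum_i u i * v i) ^+ 2 <= (\sum_i u i ^+ 2) * (\sum_i v i ^+ 2).
Proof.
rewrite -subr_ge0 -(@pmulrn_lge0 _ _ 2)//.
suff -> : ((\sum_i u i ^+ 2) * (\sum_i v i ^+ 2) - (\sum_i u i * v i) ^+ 2) *+ 2 =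
    \sum_i \sum_j (u i * v j - u j * v i) ^+ 2.
  by apply: sumr_ge0 => i _; apply: sumr_ge0 => j _; exact: sqr_ge0.
transitivity (\sum_i \sum_j (u i ^+ 2 * v j ^+ 2 - u i * v i * (u j * v j)) +
              \sum_i \sum_j (u j ^+ 2 * v i ^+ 2 - u i * v i * (u j * v j))).
  rewrite [X in _ = _ + X](_ : _ = \sum_i \sum_j (u i ^+ 2 * v j ^+ 2 - u i * v i * (u j * v j))).
    rewrite -mulr2n; congr (_ *+ _); rewrite expr2 !mulr_suml -sumrB.
    by apply: eq_bigr => i _; rewrite !mulr_sumr -sumrB.
  rewrite exchange_big; apply: eq_bigr => i _; apply: eq_bigr => j _.
  by rewrite [X in _ - X]mulrC.
rewrite -big_split; apply: eq_bigr => i _; rewrite -big_split.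
by apply: eq_bigr => j _ /=; ring.
Qed.

Lemma mxtrace_mul_trE (R : comPzRingType) (m n : nat) (A : 'M[R]_(m, n)) :
  \tr (A *m A^T) = \sum_i \sum_j A i j ^+ 2.
Proof.
by apply: eq_bigr => i _; rewrite mxE; apply: eq_bigr => j _; rewrite mxE expr2.
Qed.

Lemma mxtrace_mul_tr_ge0 (R : realFieldType) (m n : nat) (A : 'M[R]_(m, n)) :
  0 <= \tr (A *m A^T).
Proof.
by rewrite mxtrace_mul_trE; apply: sumr_ge0 => i _; apply: sumr_ge0 => j _; exact: sqr_ge0.
Qed.

Lemma frobenius_mul_le (R : realFieldType) (m n p : nat)
    (A : 'M[R]_(m, n)) (B : 'M[R]_(n, p)) :
  \tr ((A *m B) *m (A *m B)^T) <= \tr (A *m A^T) * \tr (B^T *m B).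
Proof.
rewrite -[X in _ *m X]trmxK [X in \tr (_ *m X)]trmxK -[X in _ * \tr (_ *m X)]trmxK.
rewrite !mxtrace_mul_trE.
rewrite mulr_suml; apply: ler_sum => i _; rewrite mulr_sumr; apply: ler_sum => j _.
rewrite mxE; apply: (le_trans (sum_mul_sqr_le _ _)); rewrite le_eqVlt; apply/orP; left.
by apply/eqP; congr (_ * _); apply: eq_bigr => k _; rewrite mxE.
Qed.

(** The Gram factor stands in for a square root of [A]: [x = z *m N], with [z *m z^T] equal to
    [x *m invmx A *m x^T]. *)
Lemma gram_inv_lower (R : realFieldType) (k m n : nat) (N : 'M[R]_(m, n))
    (x : 'M[R]_(k, n)) (A := N^T *m N) : A \in unitmx ->
  \tr (x *m x^T) <= \tr A * \tr (x *m invmx A *m x^T).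
Proof.
move=> Au; have At : (invmx A)^T = invmx A.
  by rewrite trmx_inv /A trmx_mul trmxK.
pose z := x *m invmx A *m N^T.
have xE : x = z *m N by rewrite /z -mulmxA -/A mulmxKV.
have -> : x *m invmx A *m x^T = z *m z^T.
  by rewrite {2}xE trmx_mul !mulmxA.
rewrite {1 2}xE mulrC; exact: frobenius_mul_le.
Qed.

Lemma exists_lower_bound (R : realFieldType) (I : finType) (P : pred I) (f : I -> R) :
  (forall i, P i -> 0 < f i) -> exists2 g, 0 < g & forall i, P i -> g <= f i.
Proof.
(* The default 1 of the minimum covers an empty index set. *)
move=> f0; exists (\big[Num.min/1]_(i | P i) f i) => [|i Pi]; last exact: bigmin_le_cond.
exact/bigmin_gtP.
Qed.

(** * Bounds on solutions and their dependence on the variogram *)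

Section Stability.
Variables (R : realType) (d : nat).
Implicit Types (Q G : 'M[R]_d) (i j : 'I_d).
Local Notation b := (edge_vec R d).

(** The rows of [N] are the edge vectors scaled by the square roots of their weights. *)
Lemma aug_gram Q : Uplus Q -> exists m (N : 'M[R]_(m, d)), aug Q = N^T *m N.
Proof.
move=> [Qs Q0 _]; pose E := option ('I_d * 'I_d).
exists #|{: E}|, (\matrix_k (Num.sqrt (edge_weight Q (enum_val k)) *: b (enum_val k))).
rewrite aug_edge_sum//; apply/matrixP => i j; rewrite summxE mxE.
rewrite [LHS](reindex _ (onW_bij _ (enum_val_bij E))) /=; apply: eq_bigr => k _.
rewrite !mxE big_ord1 !mxE mulrACA -expr2 sqr_sqrtr ?edge_weight_ge0//.
Qed.

Lemma tr_inv_aug Q Q' : sym0 Q' ->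
  \tr (invmx (aug Q) *m aug Q') = (b None *m invmx (aug Q) *m (b None)^T) 0 0 +
    \sum_(i < d) \sum_(j < d | (i < j)%N) resistance Q i j * Q' i j.
Proof.
move=> Qs; have tr1 e : \tr (invmx (aug Q) *m ((b e)^T *m b e)) =
    (b e *m invmx (aug Q) *m (b e)^T) 0 0.
  by rewrite mulmxA mxtrace_mulC mulmxA [LHS]big_ord1.
rewrite [aug Q']aug_edge_sum// mulmx_sumr raddf_sum/=.
under eq_bigr do rewrite -scalemxAr mxtraceZ tr1.
rewrite sum_option_pair mul1r; congr (_ + _).
apply: eq_bigr => i _; rewrite [RHS]big_mkcond; apply: eq_bigr => j _ /=.
by case: ifP => _; rewrite ?mul0r// mulrC.
Qed.

Lemma tr_aug_gt0 Q : (0 < d)%N -> Uplus Q -> 0 < \tr (aug Q).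
Proof.
move=> d0 [_ Q0 _]; rewrite (_ : \tr _ = \sum_i (1 + \sum_(k | k != i) Q i k)).
  apply: (@lt_le_trans _ _ (\sum_(i < d) 1)); first by rewrite sumr_const card_ord pmulrn_lgt0.
  by apply: ler_sum => i _; rewrite lerDl; apply: sumr_ge0.
by apply: eq_bigr => i _; rewrite !mxE eqxx addrC.
Qed.

(** For [Q' = Q] the identity [tr_inv_aug] has left side [d]; complementary slackness turns its edge
    sum into [mxdot G Q], and the all-ones term is nonnegative. *)
Lemma KKT_mxdot_le G Q : (0 < d)%N -> KKT G Q -> mxdot G Q <= d%:R.
Proof.
move=> d0 [QU kkt]; have [Qs _ _] := QU; have Au := aug_unit QU.
have := tr_inv_aug Q Qs; rewrite mulVmx// mxtrace1 => ->.
rewrite -[leLHS]add0r lerD//.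
  have [m [N NE]] := aug_gram QU.
  have := @gram_inv_lower _ 1 _ _ N (b None); rewrite -NE => /(_ Au).
  rewrite [X in _ * X]big_ord1; have := mxtrace_mul_tr_ge0 (b None).
  by move=> /le_trans /[apply]; rewrite pmulr_rge0// tr_aug_gt0.
apply: ler_sum => i _; apply: ler_sum => j ij.
have [->|Qij] := eqVneq (Q i j) 0; first by rewrite !mulr0.
by have [_ /(_ Qij) ->] := kkt _ _ ij.
Qed.

Lemma KKT_edge_le G Q g : (0 < d)%N -> 0 < g -> KKT G Q ->
  (forall i j, i != j -> g <= G i j) -> forall i j, Q i j <= d%:R / g.
Proof.
move=> d0 g0 kkt gG; have [[[Qt Q00] Q0 _] _] := kkt.
have Glt (i j : 'I_d) : (i < j)%N -> Q i j <= d%:R / g.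
  move=> ij; rewrite ler_pdivlMr//; apply: le_trans (KKT_mxdot_le d0 kkt).
  have pos (k l : 'I_d) : (k < l)%N -> g * Q k l <= G k l * Q k l.
    by move=> kl; rewrite ler_wpM2r// gG// neq_ltn kl.
  rewrite /mxdot (bigD1 i)//= (bigD1 j)//= -addrA mulrC; apply: ler_wpDr; last exact: pos.
  have pos0 (k l : 'I_d) : (k < l)%N -> 0 <= G k l * Q k l.
    by move=> /pos; apply: le_trans; rewrite mulr_ge0// ltW.
  apply: addr_ge0; first by apply: sumr_ge0 => l /andP[il _]; exact: pos0.
  by apply: sumr_ge0 => k _; apply: sumr_ge0 => l; exact: pos0.
move=> i j; have [ij|ji|/val_inj->] := ltngtP i j.
- exact: Glt.
- by rewrite -Qt mxE Glt.
- by rewrite Q00 divr_ge0// ltW.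
Qed.

Lemma tr_aug_le G Q g : (0 < d)%N -> 0 < g -> KKT G Q ->
  (forall i j, i != j -> g <= G i j) -> \tr (aug Q) <= d%:R * (d%:R * (d%:R / g) + 1).
Proof.
move=> d0 g0 kkt gG; have Qle := KKT_edge_le d0 g0 kkt gG.
have [[_ Q0 _] _] := kkt.
rewrite -[X in X%:R * (_ + _)]card_ord mulr_natl -sumr_const; apply: ler_sum => i _.
rewrite !mxE eqxx lerD2r -[X in X%:R * _]card_ord mulr_natl -sumr_const.
rewrite big_mkcond; apply: ler_sum => j _; case: ifP => // _.
by rewrite divr_ge0// ltW.
Qed.

Lemma mul_inv_sub Q1 Q2 (D := aug Q2 - aug Q1) : Uplus Q1 -> Uplus Q2 ->
  invmx (aug Q1) *m D *m invmx (aug Q2) = invmx (aug Q1) - invmx (aug Q2).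
Proof.
move=> /aug_unit U1 /aug_unit U2.
by rewrite mulmxBr mulmxBl mulVmx// mul1mx mulmxK.
Qed.

(* Strong monotonicity of [A |-> - A^-1] on positive definite matrices. *)
Lemma tr_inv_monotone Q1 Q2 (D := aug Q2 - aug Q1) : (0 < d)%N -> Uplus Q1 -> Uplus Q2 ->
  \tr (D *m D^T) <= \tr (aug Q1) * \tr (aug Q2) *
    \tr ((invmx (aug Q1) - invmx (aug Q2)) *m D).
Proof.
move=> d0 U1 U2; rewrite -mul_inv_sub// -/D.
have [m1 [N1 E1]] := aug_gram U1; have [m2 [N2 E2]] := aug_gram U2.
have A1u := aug_unit U1; have A2u := aug_unit U2.
have [Qs1 _ _] := U1; have [Qs2 _ _] := U2.
have Dt : D^T = D by rewrite linearB /= (aug_sym Qs1) (aug_sym Qs2).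
have A1t : (invmx (aug Q1))^T = invmx (aug Q1).
  by rewrite trmx_inv aug_sym.
(* [V] is a Gram factor of the inverse of the first matrix; through it the lower bound is applied a
   second time, to [V *m D]. *)
pose V := N1 *m invmx (aug Q1).
have VV : V^T *m V = invmx (aug Q1).
  by rewrite /V trmx_mul A1t -mulmxA (mulmxA N1^T) -E1 mulmxV// mulmx1.
clearbody V.
have S1 : \tr (D *m D^T) <= \tr (aug Q1) * \tr (D *m invmx (aug Q1) *m D^T).
  by rewrite E1; apply: gram_inv_lower; rewrite -E1.
have S2 : \tr (V *m D *m (V *m D)^T) <=
    \tr (aug Q2) * \tr (V *m D *m invmx (aug Q2) *m (V *m D)^T).
  by rewrite E2; apply: gram_inv_lower; rewrite -E2.
apply: (le_trans S1); rewrite -mulrA ler_wpM2l ?(ltW (tr_aug_gt0 _ _))//.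
have e1 : \tr (V *m D *m (V *m D)^T) = \tr (D *m invmx (aug Q1) *m D^T).
  by rewrite mxtrace_mulC trmx_mul mulmxA -(mulmxA D^T) VV Dt.
have e2 : \tr (V *m D *m invmx (aug Q2) *m (V *m D)^T) =
    \tr (invmx (aug Q1) *m D *m invmx (aug Q2) *m D).
  by rewrite trmx_mul Dt mulmxA mxtrace_mulC !mulmxA VV.
by rewrite -e1 -e2.
Qed.

(** The all-ones terms cancel. An edge of the support contributes equally to both sides; elsewhere
    [Q i j = 0], and the nonnegative [Q' i j] multiplies a resistance at most [G i j]. *)
Lemma KKT_tr_le G Q Q' : KKT G Q -> Uplus Q' ->
  \tr (invmx (aug Q) *m (aug Q' - aug Q)) <= mxdot G (Q' - Q).
Proof.
move=> [[Qs _ _] kkt] [Qs' Q0' _]; rewrite mulmxBr linearB /= !tr_inv_aug//.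
rewrite opprD addrACA subrr add0r -sumrB.
apply: ler_sum => i _; rewrite -sumrB; apply: ler_sum => j ij.
have [le eq] := kkt _ _ ij; rewrite !mxE mulrBr.
have [->|/eq->//] := eqVneq (Q i j) 0; rewrite !mulr0 !subr0.
by rewrite ler_wpM2r.
Qed.

(** This is Hölder continuity of order 1/2, uniform over the variograms with off-diagonal entries at
    least [g]. *)
Lemma KKT_stable g : (0 < d)%N -> 0 < g -> exists2 C : R, 0 < C &
  forall G1 G2 Q1 Q2 delta, KKT G1 Q1 -> KKT G2 Q2 ->
    (forall i j, i != j -> g <= G1 i j) -> (forall i j, i != j -> g <= G2 i j) ->
    (forall i j, `|G1 i j - G2 i j| <= delta) ->
    forall i j, i != j -> (Q2 i j - Q1 i j) ^+ 2 <= C * delta.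
Proof.
move=> d0 g0; pose q := d%:R / g; pose B := d%:R * (d%:R * q + 1).
have dR : 0 < d%:R :> R by rewrite ltr0n.
have q0 : 0 < q by rewrite divr_gt0.
have B0 : 0 < B by rewrite mulr_gt0// ltr_wpDl// mulr_ge0// ltW.
(* The factors [B] bound the two traces; the rest bounds, per unit of [delta], the pairing of
   [G1 - G2] with [Q2 - Q1], a sum of at most [d * d] terms. *)
exists (B * B * (d%:R * (d%:R * q))).
  by clearbody B q; rewrite !mulr_gt0.
move=> G1 G2 Q1 Q2 delta kkt1 kkt2 gG1 gG2 Gdelta i j ij.
have [U1 _] := kkt1; have [U2 _] := kkt2; pose D := aug Q2 - aug Q1.
have Q1le := KKT_edge_le d0 g0 kkt1 gG1; have Q2le := KKT_edge_le d0 g0 kkt2 gG2.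
have B1 : \tr (aug Q1) <= B := tr_aug_le d0 g0 kkt1 gG1.
have B2 : \tr (aug Q2) <= B := tr_aug_le d0 g0 kkt2 gG2.
rewrite -/q in Q1le Q2le; clearbody B q.
have delta0 : 0 <= delta by exact: le_trans (Gdelta i j).
apply: (@le_trans _ _ (\tr (D *m D^T))).
  rewrite mxtrace_mul_trE (bigD1 i)//= (bigD1 j)//= -addrA; apply: ler_wpDr.
    apply: addr_ge0; apply: sumr_ge0 => k _; first exact: sqr_ge0.
    by apply: sumr_ge0 => l _; exact: sqr_ge0.
  by rewrite !mxE (negbTE ij) le_eqVlt; apply/orP; left; apply/eqP; ring.
apply: (le_trans (tr_inv_monotone d0 U1 U2)); rewrite -/D -[leRHS]mulrA.
have trD : \tr ((invmx (aug Q1) - invmx (aug Q2)) *m D) <= d%:R * (d%:R * q) * delta.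
  rewrite mulmxBl linearB /=.
  have := KKT_tr_le kkt1 U2; rewrite -/D => le1.
  have := KKT_tr_le kkt2 U1; rewrite -opprB -/D mulmxN linearN /= => le2.
  apply: (le_trans (lerD le1 le2)); rewrite -big_split /=.
  rewrite -!mulrA -[X in X%:R * _]card_ord mulr_natl -sumr_const; apply: ler_sum => k _.
  rewrite -big_split /= -[X in X%:R * _]card_ord mulr_natl -sumr_const big_mkcond /=.
  apply: ler_sum => l _; case: ifP => kl; last exact: mulr_ge0 (ltW q0) delta0.
  rewrite !mxE (_ : _ + _ = (Q2 k l - Q1 k l) * (G1 k l - G2 k l)); last by ring.
  apply: (le_trans (ler_norm _)); rewrite normrM; apply: ler_pM => //.
  (* Both weights lie between 0 and [q], so they differ by at most [q]. *)
  have [[_ Q10 _] [_ Q20 _]] := (U1, U2).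
  rewrite ler_norml lerBlDl lerBrDl; apply/andP; split.
    by rewrite lerBlDr; apply: ler_wpDl.
  by apply: ler_wpDl.
have tr12 : 0 < \tr (aug Q1) * \tr (aug Q2) by rewrite mulr_gt0 ?tr_aug_gt0.
apply: ler_pM => //; first exact: ltW.
  rewrite -(pmulr_rge0 _ tr12); apply: le_trans (tr_inv_monotone d0 U1 U2).
  exact: mxtrace_mul_tr_ge0.
by apply: ler_pM => //; rewrite ltW ?tr_aug_gt0.
Qed.

(** A weight lost from the support would have changed by at least [q], a lower bound for the nonzero
    weights of [Q]. *)
Lemma KKT_support_stable G Q : (0 < d)%N -> pos_offdiag G -> KKT G Q ->
  exists2 delta, 0 < delta & forall G' : 'M[R]_d,
    (forall i j, `|G i j - G' i j| < delta) ->
    pos_offdiag G' /\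
    forall Q', KKT G' Q' -> forall i j, i != j -> Q i j != 0 -> Q' i j != 0.
Proof.
move=> d0 Gpos kkt; have [[_ Q0 _] _] := kkt.
have [g g0 gG] : exists2 g, 0 < g & forall i j, i != j -> g <= G i j.
  have [|g g0 gG] := @exists_lower_bound R _ [pred p | p.1 != p.2] (fun p => G p.1 p.2).
    by move=> [i j]; exact: Gpos.
  by exists g => // i j ij; exact: (gG (i, j)).
have [q q0 qQ] : exists2 q, 0 < q & forall i j, Q i j != 0 -> q <= Q i j.
  have [|q q0 qQ] := @exists_lower_bound R _ [pred p | Q p.1 p.2 != 0] (fun p => Q p.1 p.2).
    by move=> [i j] /= Qij; rewrite lt_neqAle eq_sym Qij Q0.
  by exists q => // i j ij; exact: (qQ (i, j)).
have g20 : 0 < g / 2 by rewrite divr_gt0.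
have [C C0 stable] := KKT_stable d0 g20.
have q2C : 0 < q ^+ 2 / (2 * C) by rewrite divr_gt0 ?exprn_gt0// mulr_gt0.
(* The first bound keeps the off-diagonal entries of [G'] at least [g / 2]; the second keeps the
   squared change of a weight at most [q ^+ 2 / 2]. *)
exists (Num.min (g / 2) (q ^+ 2 / (2 * C))); first by rewrite lt_min g20.
move=> G' GG'.
have gG' i j : i != j -> g / 2 <= G' i j.
  move=> ij; have := gG _ _ ij; have := GG' i j; rewrite lt_min => /andP[+ _].
  by rewrite ltr_norml => /andP[_]; lra.
split=> [i j ij|Q' kkt' i j ij Qij]; first exact: lt_le_trans (gG' _ _ ij).
have gG2 k l : k != l -> g / 2 <= G k l.
  by move=> kl; apply: le_trans (gG _ _ kl); rewrite ler_pdivrMr// ler_pMr// ler1n.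
have le_delta k l : `|G k l - G' k l| <= q ^+ 2 / (2 * C).
  by apply: ltW; have := GG' k l; rewrite lt_min => /andP[].
have := stable _ _ _ _ _ kkt kkt' gG2 gG' le_delta _ _ ij.
have -> : C * (q ^+ 2 / (2 * C)) = q ^+ 2 / 2 by field; rewrite lt0r_neq0.
apply: contraTneq => ->; rewrite sub0r sqrrN -ltNge.
have := qQ _ _ Qij; nra.
Qed.

End Stability.

(** * Measurability and the limit *)

Lemma mx_norm_ltP (R : realType) (m n : nat) (A : 'M[R]_(m, n)) (e : R) : 0 < e ->
  `|A| < e <-> forall i j, `|A i j| < e.
Proof.
move=> e0; rewrite [`|A|]mx_normrE; split=> [/bigmax_ltP[_ Ae] i j|Ae].
  exact: (Ae (i, j)).
by apply/bigmax_ltP; split=> // -[i j] _; exact: Ae.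
Qed.

Section MeasurableMatrices.
Variables (R : realType) (d : nat) (disp : measure_display).
Variables (Omega : measurableType disp) (X : Omega -> 'M[R]_d).
Hypothesis mX : forall i j, measurable_fun setT (fun w => X w i j).

Lemma measurable_forall (J : finType) (S : J -> Omega -> Prop) :
  (forall i, measurable [set w | S i w]) -> measurable [set w | forall i, S i w].
Proof.
move=> mS; rewrite (_ : [set w | _] = \bigcap_(i in setT) [set w | S i w]).
  exact: fin_bigcap_measurable.
by apply/seteqP; split=> [w Sw i _|w Sw i]; [exact: Sw | exact: Sw i I].
Qed.

Lemma measurable_box (c : 'M[R]_d) (r : R) :
  measurable [set w | forall i j, `|X w i j - c i j| < r].
Proof.
apply: measurable_forall => i; apply: measurable_forall => j.
rewrite [X in measurable X](_ : _ = setT `&`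
    (fun w => X w i j) @^-1` [set` `]c i j - r, c i j + r[]).
  by apply: mX => //; exact: measurable_itv.
apply/seteqP; rewrite setTI.
by split=> w /=; rewrite in_itv/= ltr_norml => /andP[? ?]; apply/andP; split; lra.
Qed.

Lemma measurable_norm_ge (c : 'M[R]_d) (r : R) : 0 < r ->
  measurable [set w | r <= `|X w - c|].
Proof.
move=> r0; rewrite -[X in measurable X]setCK; apply: measurableC.
rewrite [X in measurable X](_ : _ = [set w | forall i j, `|X w i j - c i j| < r]).
  exact: measurable_box.
apply/seteqP; split=> w /=.
  move=> /negP; rewrite -ltNge => /(mx_norm_ltP _ r0) Xc i j.
  by have := Xc i j; rewrite !mxE.
move=> Xc; apply/negP; rewrite -ltNge; apply/(mx_norm_ltP _ r0) => i j.
by rewrite !mxE.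
Qed.

Lemma measurable_pos_offdiag : measurable [set w | pos_offdiag (X w)].
Proof.
apply: measurable_forall => i; apply: measurable_forall => j.
have [->|ij] := eqVneq i j.
  by rewrite (_ : [set w | _] = setT)//; apply/seteqP; split.
rewrite [X in measurable X](_ : _ = setT `&` (fun w => X w i j) @^-1` [set` `]0, +oo[]).
  by apply: mX => //; exact: measurable_itv.
rewrite setTI; apply/seteqP; split=> w /=; rewrite in_itv/= andbT; first exact.
by [].
Qed.

(* Covering [S] by the countably many rational boxes whose trace on [D] lies in [S]. *)
Lemma measurable_relatively_open (S D : set Omega) : measurable D -> S `<=` D ->
  (forall w, S w -> exists2 r, 0 < r & forall w', D w' ->
     (forall i j, `|X w i j - X w' i j| < r) -> S w') ->
  measurable S.
Proof.
move=> mD SD Sopen.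
pose box (p : 'M[rat]_d * rat) :=
  [set w | forall i j, `|X w i j - (map_mx ratr p.1 : 'M[R]_d) i j| < ratr p.2].
pose good := [set p | D `&` box p `<=` S].
have -> : S = D `&` \bigcup_p (if `[< good p >] then box p else set0).
  apply/seteqP; split=> [w Sw|w [Dw [p _]]]; last first.
    by case: asboolP => // gp wp; exact: gp.
  split; first exact: SD.
  have [r r0 Sr] := Sopen _ Sw.
  (* Two points of a box of radius [q < r / 2] have entries within [r] of each other. *)
  have [q /[!in_itv]/= /andP[q0 qr]] := rat_in_itvoo (divr_gt0 r0 (ltr0n R 2)).
  have /fin_all_exists[c cX] (ij : 'I_d * 'I_d) :
      exists a : rat, ratr a \in `]X w ij.1 ij.2 - ratr q, X w ij.1 ij.2 + ratr q[.
    by apply: rat_in_itvoo; rewrite ltrBlDr -addrA ltrDl addr_gt0.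
  pose C := \matrix_(i, j) c (i, j); have wC : box (C, q) w.
    move=> i j; have := cX (i, j); rewrite !mxE in_itv/= ltr_norml => /andP[] *.
    by apply/andP; split; lra.
  exists (C, q) => //; case: asboolP => //; case=> w' [Dw' w'C].
  apply: (Sr _ Dw') => i j; have := w'C i j; have := wC i j.
  rewrite !ltr_norml => /andP[? ?] /andP[? ?]; apply/andP; split; lra.
apply: measurableI => //; apply: countable_bigcupT_measurable; first exact: countableP.
by move=> p; case: ifP => // _; exact: measurable_box.
Qed.

End MeasurableMatrices.

Theorem theorem5p9 (R : realType) (d : nat)
    (disp : measure_display) (Omega : measurableType disp) (P : probability Omega R)
    (Gam : 'M[R]_d) (E : rel 'I_d)
    (Gbar Qhat Ghat : nat -> Omega -> 'M[R]_d) :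
  cond_negdef Gam -> EMTP2 Gam ->
  symmetric E -> irreflexive E ->
  (forall i j, i != j -> HR_precision Gam i j = 0 <-> ~~ E i j) ->
  (forall n w, sym0 (Gbar n w)) ->
  (forall n i j, measurable_fun setT (fun w => Gbar n w i j)) ->
  cvg_in_prob P Gbar Gam ->
  (forall n w, pos_offdiag (Gbar n w) ->
     EMTP2_estimator (Gbar n w) (Qhat n w) (Ghat n w)) ->
  (forall n i j, measurable_fun [set w | ~ pos_offdiag (Gbar n w)]
     (fun w => Qhat n w i j)) ->
  (fun n => P [set w | subrel E (support_graph (Qhat n w))]) @ \oo --> 1%E.
Proof.
move=> Gam_negdef emtp _ Eirr EP Gs mG Gcvg Qest mQ.
pose pos n := [set w | pos_offdiag (Gbar n w)].
have mpos n : measurable (pos n) by exact: measurable_pos_offdiag.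
have EQ i j : E i j -> i != j by apply: contraTneq => ->; rewrite Eirr.
pose A n := [set w | subrel E (support_graph (Qhat n w))].
have kkt n w : (0 < d)%N -> pos n w -> KKT (Gbar n w) (Qhat n w).
  by move=> d0 /Qest[Qam _]; exact: argmax_KKT.
(* On the event of positive entries the set is relatively open, by stability of the support; on the
   complement [mQ] applies. *)
have mQ0 n i j : i != j -> measurable [set w | Qhat n w i j != 0].
  move=> ij; have d0 : (0 < d)%N by exact: leq_ltn_trans (ltn_ord i).
  rewrite [X in measurable X](_ : _ = (pos n `&` [set w | Qhat n w i j != 0]) `|`
      (~` pos n `&` (fun w => Qhat n w i j) @^-1` ~` [set 0])); last first.
    rewrite -[LHS]setTI -(setUv (pos n)) setIUl; congr (_ `|` (_ `&` _)).
    by apply/seteqP; split=> w /= /eqP.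
  apply: measurableU; last first.
    by apply: mQ; [exact: measurableC (mpos n) | apply: measurableC; exact: measurable_set1].
  apply: (measurable_relatively_open (mG n) (mpos n)) => [w []//|w [/= wpos Qw]].
  have [r r0 rP] := KKT_support_stable d0 wpos (kkt _ _ d0 wpos).
  exists r => // w' w'pos /rP[_ /(_ _ (kkt _ _ d0 w'pos) _ _ ij Qw) Qw'].
  by split.
have mA n : measurable (A n).
  rewrite (_ : A n = [set w | forall i j, E i j -> support_graph (Qhat n w) i j])//.
  apply: measurable_forall => i; apply: measurable_forall => j.
  have [ij|Eij] := boolP (E i j); last first.
    by rewrite (_ : [set w | _] = setT)//; apply/seteqP; split.
  rewrite (_ : [set w | _] = [set w | Qhat n w i j != 0]); first exact: mQ0 (EQ _ _ ij).
  apply/seteqP; split=> w /=; first by move=> /(_ isT)/andP[].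
  by move=> Qw _; rewrite /support_graph EQ.
(* The radius comes from stability of the support at [Gam], where the solution has edge set [E]; for
   [d = 0] there are no vertices and any radius does. *)
have [r r0 rA] : exists2 r, 0 < r & forall n, ~` [set w | r <= `|Gbar n w - Gam|] `<=` A n.
  have [d0|d_le0] := ltnP 0 d; last first.
    by exists 1 => // n w _ i; have := leq_trans (ltn_ord i) d_le0.
  have Gpos := cond_negdef_pos Gam_negdef.
  have [r r0 rP] := KKT_support_stable d0 Gpos (KKT_precision_weights d0 Gam_negdef emtp).
  exists r => // n w /negP; rewrite -ltNge distrC => /(mx_norm_ltP _ r0) Gw i j Eij.
  have [|wpos wP] := rP (Gbar n w); first by move=> k l; have := Gw k l; rewrite !mxE.
  have ij := EQ _ _ Eij; rewrite /support_graph ij /=.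
  apply: (wP _ (kkt _ _ d0 wpos)) => //.
  rewrite mxE (negbTE ij) oppr_eq0; apply/eqP => /(EP _ _ ij).
  by rewrite Eij.
have lower : (fun n => 1 - P [set w | (r <= `|Gbar n w - Gam|)%R])%E @ \oo --> 1%E.
  by rewrite -[X in _ --> X]sube0; apply: cvgeB => //; [exact: cvg_cst | exact: Gcvg].
apply: (squeeze_cvge _ lower (cvg_cst _)); near=> n.
apply/andP; split; last exact: (probability_le1 P (mA n)).
rewrite -probability_setC; last exact: measurable_norm_ge.
apply: le_measure; last exact: rA.
  by rewrite inE; apply: measurableC; exact: measurable_norm_ge.
by rewrite inE; exact: mA.
Unshelve. all: by end_near.
Qed.
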